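(* Let $(\mathcal{G}\rightrightarrows M,\omega+\eta)$ be a 1-shifted symplectic groupoid with corresponding Dirac structure $\mathbf{L}=(\mathtt{a}_{\mathcal{G}},\lambda_\omega)(A_{\mathcal{G}})\subset\mathbb{T}_\eta M$, and let $(\mathcal{H},\Phi,\sigma)$, $\mathcal{H}\rightrightarrows N$, be an isotropic morphism into it, with $\phi=\Phi|_N$. Then $(\mathcal{H},\Phi,\sigma)$ is lagrangian if and only if the Lie algebroid morphism $$A_{\mathcal{H}}\xrightarrow{(\mathtt{a}_{\mathcal{H}},\mathrm{Lie}(\Phi))}TN\times A_{\mathcal{G}}\xrightarrow{\ \sim\ }TN\times\mathbf{L}$$ (the second map being $\mathrm{id}\times(\mathtt{a}_{\mathcal{G}},\lambda_\omega)$) is an isomorphism onto $R_{\phi,\sigma}\cap(TN\times\mathbf{L})$.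
   Context: Everything is real and $C^\infty$. For a Lie groupoid $\mathcal{G}\rightrightarrows M$: source $\mathtt{s}$, target $\mathtt{t}$, multiplication $\mathtt{m}$ (defined when $\mathtt{s}(g)=\mathtt{t}(h)$); $A_{\mathcal{G}}=\ker(T\mathtt{s})|_M$, anchor $\mathtt{a}_{\mathcal{G}}=T\mathtt{t}$, bracket by right-invariant vector fields. A 1-shifted symplectic (= quasi-symplectic) groupoid $(\mathcal{G}\rightrightarrows M,\omega+\eta)$: $\omega\in\Omega^2(\mathcal{G})$, $\eta\in\Omega^3(M)$ with $\mathtt{m}^*\omega=\mathrm{pr}_1^*\omega+\mathrm{pr}_2^*\omega$, $d\omega=\mathtt{s}^*\eta-\mathtt{t}^*\eta$, $d\eta=0$, $\dim\mathcal{G}=2\dim M$ and $\ker(T\mathtt{s})_x\cap\ker(\omega)_x\cap\ker(T\mathtt{t})_x=0$ for $x\in M$. Set $\lambda_\omega:A_{\mathcal{G}}\to T^*M$, $\lambda_\omega(u)=(i_u\omega)|_{TM}$. Then $(\mathtt{a}_{\mathcal{G}},\lambda_\omega)$ embeds $A_{\mathcal{G}}$ as a Dirac structure $\mathbf{L}$ in $\mathbb{T}_\eta M$ (the bundle $TM\oplus T^*M$ with its canonical pairing and bracket $[X,Y]+\mathcal{L}_X\beta-i_Yd\alpha+i_Yi_X\eta$ of $X+\alpha$, $Y+\beta$). An isotropic morphism $(\mathcal{H},\Phi,\sigma)$: a Lie groupoid morphism $\Phi:(\mathcal{H}\rightrightarrows N)\to\mathcal{G}$ with $\sigma\in\Omega^2(N)$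 such that $\mathtt{s}^*\sigma-\mathtt{t}^*\sigma=\Phi^*\omega$ and $d\sigma=\phi^*\eta$. It is lagrangian if the sequence of vector bundles over $N$ $$0\to A_{\mathcal{H}}\to TN\oplus\phi^*A_{\mathcal{G}}\to\phi^*TM\oplus T^*N\to A_{\mathcal{H}}^*\to0$$ with maps $w\mapsto(\mathtt{a}_{\mathcal{H}}(w),\mathrm{Lie}(\Phi)(w))$, $(Y,u)\mapsto(T\phi(Y)-\mathtt{a}_{\mathcal{G}}(u),\ \sigma^\flat(Y)+T^*\phi(\lambda_\omega(u)))$ (where $\sigma^\flat(Y)=\sigma(Y,\cdot)$), and $(X,\alpha)\mapsto-\mathrm{Lie}(\Phi)^*(\lambda_\omega^*(X))+\mathtt{a}_{\mathcal{H}}^*(\alpha)$, is exact (equivalently, the associated chain map from the normal complex of $\Phi$ to the cotangent complex of $\mathcal{H}$ is a quasi-isomorphism). $R_{\phi,\sigma}=\{((Y,\beta),(X,\alpha)):Y\in T_xN,\ X=T\phi(Y),\ \alpha\in T^*_{\phi(x)}M,\ \beta=(T\phi)^*\alpha+i_Y\sigma,\ x\in N\}$, a Dirac structure in $\mathbb{T}N\times\overline{\mathbb{T}_\eta M}$ supported on $\mathrm{Graph}(\phi)$ (the bar denotes the opposite pairing). $TN\times\mathbf{L}$ denotes the pairs $((Y,0),(X,\alpha))$ with $(X,\alpha)\in\mathbf{L}$, and the intersection is taken over $\mathrm{Graph}(\phi)\cong N$. The isotropic condition guarantees that the image of the displayed map lies in $R_{\phi,\sigma}\cap(TN\times\mathbf{L})$.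 *)

(* Defs.v *)
From HB Require Import structures.
From mathcomp Require Import all_boot all_order all_algebra.
From mathcomp Require Import all_classical all_reals all_analysis.

Set Implicit Arguments.
Unset Strict Implicit.
Unset Printing Implicit Defensive.

Import Order.TTheory GRing.Theory Num.Theory.
Import numFieldNormedType.Exports.

Local Open Scope classical_set_scope.
Local Open Scope ring_scope.

(** * Smooth maps between (finite-dimensional) normed spaces *)

Fixpoint Ck (R : realType) (V W : normedModType R) (k : nat) (U : set V)
    (f : V -> W) : Prop :=
  if k is k'.+1 then
    (forall p, U p -> differentiable f p) /\
    (forall v, Ck k' U (fun p => 'd f p v))
  else forall p, U p -> {for p, continuous f}.

Definition smooth_on (R : realType) (V W : normedModType R) (U : set V)
    (f : V -> W) : Prop := forall k, Ck k U f.

Definition smooth_at (R : realType) (V W : normedModType R) (f : V -> W)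
    (p : V) : Prop := exists2 U, open_nbhs p U & smooth_on U f.

(** * Smooth manifolds *)

(* [param] inverts [coord] on [coord @` dom]; it is arbitrary elsewhere. *)
Record chart (R : realType) (T : topologicalType) (n : nat) := Chart {
  dom : set T;
  coord : T -> 'rV[R]_n;
  param : 'rV[R]_n -> T;
  dom_open : open dom;
  coord_open : open (coord @` dom);
  coordK : forall x, dom x -> param (coord x) = x;
  coord_continuous : forall x, dom x -> {for x, continuous coord};
  param_continuous :
    forall p, (coord @` dom) p -> {for p, continuous param} }.

(* The atlas is indexed by the points of the manifold: [chart_at x] is a chart
   around [x].  Every smooth structure is generated by such an atlas, and a
   tangent vector at [x] can then be represented by its coordinates in
   [chart_at x]. *)
Record manifold (R : realType) := Manifold {
  points :> topologicalType;
  mdim : nat;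
  chart_at : points -> chart R points mdim;
  points_hausdorff : hausdorff_space points;
  points_second_countable : @second_countable points;
  mem_chart_at : forall x, dom (chart_at x) x;
  chart_at_compatible : forall x y,
    smooth_on (coord (chart_at x) @` (dom (chart_at x) `&` dom (chart_at y)))
      (coord (chart_at y) \o param (chart_at x)) }.

Section calculus.
Variable R : realType.
Implicit Types M N : manifold R.

Definition tangent M (x : M) : vectType R := 'rV[R]_(mdim M).

Definition cotangent M (x : M) : vectType R := 'Hom(tangent x, R^o).

Definition local_rep M N (f : M -> N) (x : M) :
    'rV[R]_(mdim M) -> 'rV[R]_(mdim N) :=
  coord (chart_at (f x)) \o f \o param (chart_at x).

Definition smooth M N (f : M -> N) : Prop :=
  continuous f /\
  forall x, smooth_at (local_rep f x) (coord (chart_at x) x).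

Definition tangent_map M N (f : M -> N) (x : M) :
    'Hom(tangent x, tangent (f x)) :=
  linfun ('d (local_rep f x) (coord (chart_at x) x)).

Definition submersion M N (f : M -> N) : Prop :=
  smooth f /\ forall x, limg (tangent_map f x) = fullv.

(** * Differential forms *)

(* The value at [param (chart_at c) p] of the coordinate vector field of
   [chart_at c] with constant components [v], in the coordinates of the chart
   at that point. *)
Definition coordinate_field M (c : M) (v p : 'rV[R]_(mdim M)) :
    tangent (param (chart_at c) p) :=
  'd (coord (chart_at (param (chart_at c) p)) \o param (chart_at c)) p v.

Definition form_in_chart M k
    (w : forall x : M, ('I_k -> tangent x) -> R) (c : M)
    (v : 'I_k -> 'rV[R]_(mdim M)) (p : 'rV[R]_(mdim M)) : R^o :=
  w (param (chart_at c) p) (fun i => coordinate_field c (v i) p).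

(* [dfwith v i u] is the tuple [v] with its [i]-th entry replaced by [u]. *)
Record diff_form M (k : nat) := DiffForm {
  form_val :> forall x : M, ('I_k -> tangent x) -> R;
  form_linear : forall x (v : 'I_k -> tangent x) i a (u u' : tangent x),
    form_val (dfwith v i (a *: u + u')) =
    a * form_val (dfwith v i u) + form_val (dfwith v i u');
  form_alternating : forall x (v : 'I_k -> tangent x) i j,
    i != j -> v i = v j -> form_val v = 0;
  form_smooth : forall (c : M) (v : 'I_k -> 'rV[R]_(mdim M)),
    smooth_on (coord (chart_at c) @` dom (chart_at c))
      (form_in_chart form_val c v) }.

Definition pullback M N k (f : M -> N)
    (w : forall y : N, ('I_k -> tangent y) -> R) (x : M)
    (v : 'I_k -> tangent x) : R :=
  w (f x) (fun i => tangent_map f x (v i)).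

(* (d w)(v_0, ..., v_k) = sum_i (-1)^i v_i (w (v_0, ..., ^v_i, ..., v_k)) for
   the constant extensions of the v_i in the chart at the base point, whose
   brackets vanish. *)
Definition extd M k (w : forall x : M, ('I_k -> tangent x) -> R) (x : M)
    (v : 'I_k.+1 -> tangent x) : R :=
  \sum_(i < k.+1) (-1) ^+ i *
    'd (form_in_chart w x (v \o lift i)) (coord (chart_at x) x) (v i).

Definition form2 M (w : diff_form M 2) (x : M) (u v : tangent x) : R :=
  w x (fun i => if i == ord0 then u else v).

Definition flat M (w : diff_form M 2) (x : M) (u : tangent x) : cotangent x :=
  linfun (form2 w u : tangent x -> R^o).

End calculus.

Section chain_rule.
Variable R : realType.

Lemma smooth_at_differentiable (V W : normedModType R) (f : V -> W) p :
  smooth_at f p -> differentiable f p.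
Proof. by case=> U [_ Up] /(_ 1%N) [+ _]; apply. Qed.

Lemma near_eq_is_diff (V W : normedModType R) (f g : V -> W) x :
  {near x, f =1 g} -> differentiable g x ->
  differentiable f x /\ 'd f x = 'd g x :> (V -> W).
Proof.
move=> fg dg; have [gc gE] := (diff_locallyP _ _).1 dg.
have fE : f \o shift x = cst (f x) + 'd g x +o_ 0 id.
  move/eqaddoP: gE => gE; apply/eqaddoP => e /gE ge.
  have {}fg : \forall y \near 0, f (y + x) = g (y + x).
    move: fg; rewrite (near_shift 0 x); apply: filterS => y.
    by rewrite /= subr0.
  have fgx : f x = g x by have /nbhs_singleton := fg; rewrite add0r.
  by apply: filterS2 fg ge => y fgy; rewrite /= !fctE fgx fgy.
have dfE := diff_unique gc fE.
split; last exact: dfE.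
apply/diff_locallyP; rewrite dfE.
exact: (conj gc fE).
Qed.

Lemma tangent_mapE (M N : manifold R) (f : M -> N) x v :
  tangent_map f x v = 'd (local_rep f x) (coord (chart_at x) x) v.
Proof. exact: lfunE. Qed.

Lemma param_coord (M : manifold R) (x : M) :
  param (chart_at x) (coord (chart_at x) x) = x.
Proof. exact/coordK/mem_chart_at. Qed.

Lemma smooth_rep_differentiable (M N : manifold R) (f : M -> N) x :
  smooth f -> differentiable (local_rep f x) (coord (chart_at x) x).
Proof. by case=> _ /(_ x) /smooth_at_differentiable. Qed.

Lemma tangent_map_comp (M N P : manifold R) (f : M -> N) (g : N -> P) x :
  smooth f -> smooth g ->
  tangent_map (g \o f) x = (tangent_map g (f x) \o tangent_map f x)%VF.
Proof.
move=> sf sg; set p := coord (chart_at x) x.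
have lf : local_rep f x p = coord (chart_at (f x)) (f x).
  by rewrite /local_rep /= param_coord.
have df : differentiable (local_rep f x) p by exact: smooth_rep_differentiable.
have dg : differentiable (local_rep g (f x)) (local_rep f x p).
  by rewrite lf; exact: smooth_rep_differentiable.
have gfE : {near p, local_rep (g \o f) x =1
    local_rep g (f x) \o local_rep f x}.
  have c : f \o param (chart_at x) @ p --> f x.
    have cp : {for p, continuous (param (chart_at x))}.
      by apply: param_continuous; exists x => //; exact: mem_chart_at.
    have cf : {for param (chart_at x) p, continuous f} by exact: sf.1.
    have fp : f (param (chart_at x) p) = f x by rewrite param_coord.
    by rewrite -fp; exact: (cvg_comp _ _ cp cf).
  have /c : nbhs (f x) (dom (chart_at (f x))).
    by apply: open_nbhs_nbhs; split; [exact: dom_open|exact: mem_chart_at].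
  move=> cA.
  have {}cA : \forall q \near p,
      dom (chart_at (f x)) (f (param (chart_at x) q)) by exact: cA.
  apply: (filterS _ cA) => q /coordK fq.
  by rewrite /local_rep /= fq.
have [_ dE] := near_eq_is_diff gfE (differentiable_comp df dg).
apply/lfunP => v.
rewrite comp_lfunE [LHS]tangent_mapE [RHS]tangent_mapE.
have fv : tangent_map f x v = 'd (local_rep f x) p v by exact: tangent_mapE.
rewrite fv [LHS](congr1 (@^~ v) dE) [LHS](congr1 (@^~ v) (diff_comp df dg)).
by rewrite /= lf.
Qed.

End chain_rule.

Section form2.
Variables (R : realType) (M : manifold R) (w : diff_form M 2) (x : M).

Lemma pair_dfwith0 (u u' v : tangent x) :
  (fun i : 'I_2 => if i == ord0 then u else v) =
  dfwith (fun i : 'I_2 => if i == ord0 then u' else v) ord0 u.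
Proof.
apply/funext => i; case: (eqVneq i ord0) => [->|i0]; first by rewrite dfwithin.
by rewrite dfwithout ?(negbTE i0) // eq_sym.
Qed.

Lemma pair_dfwith1 (u v v' : tangent x) :
  (fun i : 'I_2 => if i == ord0 then u else v) =
  dfwith (fun i : 'I_2 => if i == ord0 then u else v') ord_max v.
Proof.
apply/funext => i; case: (eqVneq i ord0) => [->|i0]; first by rewrite dfwithout.
have -> : i = ord_max by apply/val_inj; case: i i0 => [[|[|]]].
by rewrite dfwithin.
Qed.

Lemma form2_linearl (v : tangent x) :
  linear (fun u : tangent x => form2 w u v : R^o).
Proof.
move=> a u u'; rewrite /form2 (pair_dfwith0 (a *: u + u') 0 v).
by rewrite (pair_dfwith0 u 0 v) (pair_dfwith0 u' 0 v); exact: form_linear.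
Qed.

Lemma form2_linearr (u : tangent x) :
  linear (fun v : tangent x => form2 w u v : R^o).
Proof.
move=> a v v'; rewrite /form2 (pair_dfwith1 u (a *: v + v') 0).
by rewrite (pair_dfwith1 u v 0) (pair_dfwith1 u v' 0); exact: form_linear.
Qed.

Lemma flatE (u v : tangent x) : flat w u v = form2 w u v.
Proof.
pose B := GRing.isLinear.Build _ _ _ _ _ (form2_linearr u).
pose F : {linear tangent x -> R^o} :=
  HB.pack (fun v : tangent x => form2 w u v : R^o) B.
exact: (lfunE F).
Qed.

Lemma flat_linear : linear (flat w (x := x)).
Proof.
move=> a u u'; apply/lfunP => v.
by rewrite add_lfunE scale_lfunE !flatE; exact: form2_linearl.
Qed.

End form2.

(** * Lie groupoids *)

(* The fibre product of [f] and [g] in the category of manifolds. *)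
Definition is_fibre_product (R : realType) (X Y B P : manifold R)
    (f : X -> B) (g : Y -> B) (p1 : P -> X) (p2 : P -> Y) : Prop :=
  [/\ smooth p1 /\ smooth p2,
      forall p, f (p1 p) = g (p2 p),
      forall p q, p1 p = p1 q -> p2 p = p2 q -> p = q &
      forall (Q : manifold R) (q1 : Q -> X) (q2 : Q -> Y),
        smooth q1 -> smooth q2 -> (forall q, f (q1 q) = g (q2 q)) ->
        exists2 h : Q -> P, smooth h &
          forall q, p1 (h q) = q1 q /\ p2 (h q) = q2 q].

(* [mult] is total, but only its values on composable pairs (those with
   [src g = tgt h]) are meaningful; it is smooth as a map on the manifold
   [composable] of composable pairs. *)
Record lie_groupoid (R : realType) := LieGroupoid {
  arrows : manifold R;
  base : manifold R;
  src : arrows -> base;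
  tgt : arrows -> base;
  idarr : base -> arrows;
  invarr : arrows -> arrows;
  mult : arrows -> arrows -> arrows;
  composable : manifold R;
  pr1 : composable -> arrows;
  pr2 : composable -> arrows;
  src_submersion : submersion src;
  tgt_submersion : submersion tgt;
  idarr_smooth : smooth idarr;
  inv_smooth : smooth invarr;
  composableP : is_fibre_product src tgt pr1 pr2;
  mult_smooth : smooth (fun p : composable => mult (pr1 p) (pr2 p));
  src_idarr : forall x, src (idarr x) = x;
  tgt_idarr : forall x, tgt (idarr x) = x;
  src_mult : forall g h, src g = tgt h -> src (mult g h) = src h;
  tgt_mult : forall g h, src g = tgt h -> tgt (mult g h) = tgt g;
  multA : forall g h k, src g = tgt h -> src h = tgt k ->
    mult g (mult h k) = mult (mult g h) k;
  mult_idl : forall g, mult (idarr (tgt g)) g = g;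
  mult_idr : forall g, mult g (idarr (src g)) = g;
  src_inv : forall g, src (invarr g) = tgt g;
  tgt_inv : forall g, tgt (invarr g) = src g;
  mult_invl : forall g, mult (invarr g) g = idarr (src g);
  mult_invr : forall g, mult g (invarr g) = idarr (tgt g) }.

Arguments src {R l} _.
Arguments tgt {R l} _.
Arguments idarr {R l} _.
Arguments invarr {R l} _.
Arguments mult {R l} _ _.
Arguments pr1 {R l} _.
Arguments pr2 {R l} _.

Record lie_groupoid_morphism (R : realType) (H G : lie_groupoid R) :=
    LieGroupoidMorphism {
  on_arrows :> arrows H -> arrows G;
  on_base : base H -> base G;
  on_arrows_smooth : smooth on_arrows;
  on_base_smooth : smooth on_base;
  src_on_arrows : forall h, src (on_arrows h) = on_base (src h);
  tgt_on_arrows : forall h, tgt (on_arrows h) = on_base (tgt h);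
  on_arrows_idarr : forall x, on_arrows (idarr x) = idarr (on_base x);
  on_arrows_mult : forall g h, src g = tgt h ->
    on_arrows (mult g h) = mult (on_arrows g) (on_arrows h) }.

Section lie_algebroid.
Variables (R : realType) (G : lie_groupoid R).

(* The fibre at [x] of ker (T s) restricted to the units. *)
Definition ker_src (x : base G) : {vspace tangent (idarr x)} :=
  lker (tangent_map src (idarr x)).

Definition algebroid (x : base G) : vectType R := subvs_of (ker_src x).

(* As [tgt (idarr x) = x], T t maps into the tangent space at [x]. *)
Definition anchor (x : base G) : 'Hom(algebroid x, tangent x) :=
  (tangent_map tgt (idarr x) \o linfun vsval)%VF.

End lie_algebroid.

(* T Phi maps ker (T s) to ker (T s) (see [vsval_lie]), so [vsproj] only
   restricts the codomain. *)
Definition lie (R : realType) (H G : lie_groupoid R)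
    (Phi : lie_groupoid_morphism H G) (x : base H) :
    'Hom(algebroid x, algebroid (on_base Phi x)) :=
  (linfun (vsproj (ker_src (on_base Phi x))) \o
   (tangent_map Phi (idarr x) \o linfun vsval))%VF.

Lemma vsval_lie (R : realType) (H G : lie_groupoid R)
    (Phi : lie_groupoid_morphism H G) (x : base H) (w : algebroid x) :
  vsval (lie Phi x w) = tangent_map Phi (idarr x) (vsval w).
Proof.
have w1 : linfun (@vsval _ _ (ker_src x)) w = vsval w by exact: lfunE.
rewrite /lie comp_lfunE [X in vsval X]lfunE comp_lfunE w1.
apply: vsprojK; rewrite memv_ker -on_arrows_idarr; apply/eqP.
rewrite -comp_lfunE -tangent_map_comp; last 2 first.
- exact: on_arrows_smooth.
- by case: (src_submersion G).
have -> : src \o Phi = on_base Phi \o src.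
  by apply/funext => h /=; exact: src_on_arrows.
rewrite tangent_map_comp; last 2 first.
- by case: (src_submersion H).
- exact: on_base_smooth.
have /eqP w0 : tangent_map src (idarr x) (vsval w) == 0.
  by rewrite -memv_ker; exact: subvsP.
by rewrite comp_lfunE w0 linear0.
Qed.

(** * Quasi-symplectic groupoids and isotropic morphisms *)

Section shifted_symplectic.
Variables (R : realType) (G : lie_groupoid R).
Variables (omega : diff_form (arrows G) 2) (eta : diff_form (base G) 3).

Definition shifted_symplectic : Prop :=
  [/\ forall p v, pullback (fun q : composable G => mult (pr1 q) (pr2 q))
          omega (x := p) v =
        pullback pr1 omega v + pullback pr2 omega v,
      forall g v, extd omega (x := g) v =
        pullback src eta v - pullback tgt eta v,
      forall x v, extd eta (x := x) v = 0,
      mdim (arrows G) = (2 * mdim (base G))%N &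
      forall (x : base G) (u : tangent (idarr x)),
        tangent_map src (idarr x) u = 0 ->
        (forall v, form2 omega u v = 0) ->
        tangent_map tgt (idarr x) u = 0 ->
        u = 0].

Definition lambda (x : base G) (u : algebroid x) : cotangent x :=
  (flat omega (vsval u) \o tangent_map idarr x)%VF.

Lemma lambdaE (x : base G) (u : algebroid x) (X : tangent x) :
  lambda u X = form2 omega (vsval u) (tangent_map idarr x X).
Proof. by rewrite comp_lfunE flatE. Qed.

Lemma lambda_linear (x : base G) : linear (@lambda x).
Proof.
move=> a u u'; apply/lfunP => X.
by rewrite add_lfunE scale_lfunE !lambdaE linearP; exact: form2_linearl.
Qed.

Definition lambda_dual (x : base G) (X : tangent x) :
    'Hom(algebroid x, R^o) :=
  linfun (fun u : algebroid x => lambda u X).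

Lemma lambda_dualE (x : base G) (X : tangent x) (u : algebroid x) :
  lambda_dual X u = lambda u X.
Proof.
have L : linear (fun u : algebroid x => lambda u X : R^o).
  by move=> a v v'; rewrite lambda_linear add_lfunE scale_lfunE.
pose B := GRing.isLinear.Build _ _ _ _ _ L.
pose F : {linear algebroid x -> R^o} :=
  HB.pack (fun u : algebroid x => lambda u X : R^o) B.
exact: (lfunE F).
Qed.

(* The fibre at [x] of TM (+) T*M. *)
Definition generalized_tangent (M : manifold R) (x : M) : vectType R :=
  (tangent x * cotangent x)%type.

Definition dirac_structure (x : base G) : set (generalized_tangent x) :=
  range (fun u : algebroid x => (anchor x u, lambda u)).

End shifted_symplectic.

Section morphisms.
Variables (R : realType) (G H : lie_groupoid R).
Variables (omega : diff_form (arrows G) 2) (eta : diff_form (base G) 3).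
Variables (Phi : lie_groupoid_morphism H G) (sigma : diff_form (base H) 2).

Local Notation phi := (on_base Phi).

Definition isotropic : Prop :=
  (forall h v, pullback src sigma (x := h) v - pullback tgt sigma v =
     pullback Phi omega v) /\
  (forall x v, extd sigma (x := x) v = pullback phi eta v).

Definition lagr1 (x : base H) (w : algebroid x) :
    (tangent x * algebroid (phi x))%type :=
  (anchor x w, lie Phi x w).

Definition lagr2 (x : base H) (z : tangent x * algebroid (phi x)) :
    (tangent (phi x) * cotangent x)%type :=
  (tangent_map phi x z.1 - anchor (phi x) z.2,
   flat sigma z.1 + (lambda omega z.2 \o tangent_map phi x)%VF).

Definition lagr3 (x : base H) (z : tangent (phi x) * cotangent x) :
    'Hom(algebroid x, R^o) :=
  - (lambda_dual omega z.1 \o lie Phi x)%VF + (z.2 \o anchor x)%VF.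

Definition lagrangian : Prop :=
  forall x : base H,
  [/\ injective (@lagr1 x),
      [set z | @lagr2 x z = 0] = range (@lagr1 x),
      [set z | @lagr3 x z = 0] = range (@lagr2 x) &
      range (@lagr3 x) = setT].

(* The fibre at [(x, phi x)] of the product of generalized tangent bundles,
   over Graph(phi), identified with N. *)
Definition ambient (x : base H) : vectType R :=
  (generalized_tangent x * generalized_tangent (phi x))%type.

(* Elements are written z = ((Y, beta), (X, alpha)). *)
Definition graph_dirac (x : base H) : set (ambient x) :=
  [set z | z.2.1 = tangent_map phi x z.1.1 /\
           z.1.2 = (z.2.2 \o tangent_map phi x)%VF + flat sigma z.1.1].

Definition tangent_times_dirac (x : base H) : set (ambient x) :=
  [set z | z.1.2 = 0 /\ dirac_structure omega z.2].

Definition to_tangent_times_dirac (x : base H)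
    (z : tangent x * algebroid (phi x)) : ambient x :=
  ((z.1, 0), (anchor (phi x) z.2, lambda omega z.2)).

End morphisms.

Arguments lagr1 {R G H} Phi x w.
Arguments lagr2 {R G H} omega Phi sigma x z.
Arguments lagr3 {R G H} omega Phi x z.
Arguments graph_dirac {R G H} Phi sigma x _.
Arguments tangent_times_dirac {R G H} omega Phi x _.
Arguments to_tangent_times_dirac {R G H} omega Phi x z.

(* A fibrewise linear map [f] between families of vector spaces is an
   isomorphism onto a family [S] of subsets of the fibres of the target.  The
   fibres of [S] are not assumed to have constant dimension: for a smooth
   bundle map [f], that they form a smooth subbundle follows, [S] being the
   image of a map of constant rank. *)
Definition isomorphism_onto (R : realType) (I : Type) (V W : I -> lmodType R)
    (f : forall i, V i -> W i) (S : forall i, set (W i)) : Prop :=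
  forall i, linear (f i) /\ set_bij setT (S i) (f i).

(* Main.v *)
(* Since [lambda] and the anchor are jointly injective, the image of the
   algebroid map equals R_{phi,sigma} \cap (TN x L) exactly when
   [ker lagr2 = im lagr1]; so the claim is that exactness at the first two
   places forces it at the last two.  Dually to the injectivity of [lagr1],
   [lagr3] is surjective: a [w] killed by [lagr3] has [a w = 0] and
   [lambda (Lie(Phi) w) = 0], whence [Lie(Phi) w = 0].  As dim A_G = dim M, the
   complex has Euler characteristic zero, so exactness at the remaining place
   follows.

   The facts about [omega] all come from pairing the tangent vectors at a unit
   of g |-> (1_{t g}, g) and g |-> (g, 1_{s g}) into the manifold of composable
   pairs; multiplicativity then gives
   omega(u, v) = omega(T1 Tt u, v) + omega(u, T1 Ts v). *)

From HB Require Import structures.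
From mathcomp Require Import all_boot all_order all_algebra.
From mathcomp Require Import all_classical all_reals all_analysis.
(* Imported last: [coord] and [coord_continuous] are also MathComp names. *)
Require Import Defs.

Set Implicit Arguments.
Unset Strict Implicit.
Unset Printing Implicit Defensive.

Import Order.TTheory GRing.Theory Num.Theory.
Import numFieldNormedType.Exports.

Local Open Scope classical_set_scope.
Local Open Scope ring_scope.

(** * Closure properties of maps of class C^k between normed spaces *)

Section calculus.
Variable R : realType.

(** [Ck k.+1] constrains [f] itself only through differentiability, so continuity of [f] comes from
    there and the rest by induction on the derivatives. *)
Lemma CkS (V W : normedModType R) k (U : set V) (f : V -> W) :
  Ck k.+1 U f -> Ck k U f.
Proof.
elim: k f => [|k IHk] f [df Df] /=.
  by move=> p Up; exact/differentiable_continuous/df.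
by split=> // v; exact/IHk/Df.
Qed.

Lemma Ck_subset (V W : normedModType R) k (U U' : set V) (f : V -> W) :
  U `<=` U' -> Ck k U' f -> Ck k U f.
Proof.
move=> sU; elim: k f => [|k IHk] f /=; first by move=> cf p /sU; exact: cf.
by case=> df Df; split=> [p /sU|v]; [exact: df|exact/IHk/Df].
Qed.

(** As [U] is open, the maps agree near each of its points, so their differentials agree on [U] as
    well and the induction can continue. *)
Lemma Ck_ext (V W : normedModType R) k (U : set V) (f g : V -> W) :
  open U -> {in U, f =1 g} -> Ck k U g -> Ck k U f.
Proof.
move=> oU; elim: k f g => [|k IHk] f g fg /= gC.
all: have near_fg p : U p -> {near p, f =1 g} by
  move=> Up; apply: filterS (open_nbhs_nbhs (conj oU Up)) => q Uq;
  exact/fg/mem_set.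
  move=> p Up; suff : f @ p --> f p by [].
  rewrite (fg _ (mem_set Up)); apply: cvg_trans (gC p Up).
  by apply: near_eq_cvg; move: (near_fg p Up); apply: filterS.
case: gC => dg Dg; split=> [p Up|v].
  by case: (near_eq_is_diff (near_fg p Up) (dg p Up)).
apply: IHk (Dg v) => p /set_mem Up.
by case: (near_eq_is_diff (near_fg p Up) (dg p Up)) => _ ->.
Qed.

Lemma Ck_cst (V W : normedModType R) k (U : set V) (w : W) :
  Ck k U (cst w).
Proof.
elim: k w => [|k IHk] w /=; first by move=> p _; exact: cst_continuous.
split=> [p _|v]; first exact: differentiable_cst.
rewrite [X in Ck _ _ X](_ : _ = cst 0); first exact: IHk.
by apply/funext => p; rewrite diff_cst.
Qed.

Lemma Ck_add (V W : normedModType R) k (U : set V) (f g : V -> W) :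
  open U -> Ck k U f -> Ck k U g -> Ck k U (f + g).
Proof.
move=> oU; elim: k f g => [|k IHk] f g /= fC gC.
  by move=> p Up; exact: continuousD (fC p Up) (gC p Up).
case: fC gC => [df Df] [dg Dg]; split=> [p Up|v].
  exact: differentiableD (df p Up) (dg p Up).
apply: Ck_ext (IHk _ _ (Df v) (Dg v)) => // p /set_mem Up.
by rewrite (diffD (df p Up) (dg p Up)).
Qed.

Lemma Ck_linear (V W X : normedModType R) k (U : set V) (f : V -> W)
    (L : {linear W -> X}) :
  open U -> continuous L -> Ck k U f -> Ck k U (L \o f).
Proof.
move=> oU cL; elim: k f => [|k IHk] f /= fC.
  by move=> p Up; apply: continuous_comp; [exact: fC|exact: cL].
have dL p : differentiable L p by exact: linear_differentiable.
case: fC => df Df; split=> [p Up|v].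
  exact: differentiable_comp (df p Up) (dL _).
apply: Ck_ext (IHk _ (Df v)) => // p /set_mem Up.
by rewrite (diff_comp (df p Up) (dL _)) /= diff_lin.
Qed.

Fact scale_is_bilinear (W : normedModType R) :
  bilinear_for
    (GRing.Scale.Law.clone _ _ *:%R _) (GRing.Scale.Law.clone _ _ *:%R _)
    (@GRing.scale R W : R^o -> W -> W).
Proof.
split=> [w|a] b x y /=; first by rewrite scalerDl scalerA.
by rewrite scalerDr !scalerA mulrC.
Qed.

HB.instance Definition _ (W : normedModType R) :=
  bilinear_isBilinear.Build R R^o W W _ _ (@GRing.scale R W : R^o -> W -> W)
    (@scale_is_bilinear W).

(** The Leibniz rule: the bilinear scaling map is composed with the pairing of [a] and [f]. *)
Lemma diff_scale (V W : normedModType R) (a : V -> R^o) (f : V -> W) p :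
  differentiable a p -> differentiable f p ->
  differentiable (fun q => a q *: f q) p /\
  'd (fun q => a q *: f q) p =
    (fun v => a p *: 'd f p v + 'd a p v *: f p) :> (V -> W).
Proof.
move=> da df; pose B : {bilinear R^o -> W -> W} := @GRing.scale R W.
have cB : continuous (fun z : R^o * W => B z.1 z.2).
  exact: scale_continuous.
have -> : (fun q => a q *: f q) =
   (fun z : R^o * W => B z.1 z.2) \o (fun q => (a q, f q)) by [].
have dp := differentiable_pair da df.
have dB := @differentiable_bilin _ _ _ _ B (a p, f p) cB.
split; first exact: differentiable_comp.
by rewrite diff_comp // diff_bilin // diff_pair.
Qed.

Lemma Ck_scale (V W : normedModType R) k (U : set V) (a : V -> R^o)
    (f : V -> W) :
  open U -> Ck k U a -> Ck k U f -> Ck k U (fun q => a q *: f q).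
Proof.
move=> oU; elim: k a f => [|k IHk] a f.
  by move=> /= aC fC p Up; exact: cvgZ (aC p Up) (fC p Up).
(* Each Leibniz term keeps one factor undifferentiated, so the induction hypothesis also needs [a]
   and [f] in the lower class. *)
move=> aC fC; have aC' := CkS aC; have fC' := CkS fC.
case: aC fC => [da Da] [df Df]; split=> [p Up|v].
  by case: (diff_scale (da p Up) (df p Up)).
apply: Ck_ext (Ck_add oU (IHk _ _ aC' (Df v)) (IHk _ _ (Da v) fC')) => //.
by move=> p /set_mem Up; case: (diff_scale (da p Up) (df p Up)) => _ ->.
Qed.

Lemma Ck_coord (V : normedModType R) n k (U : set V) (f : V -> 'rV[R]_n) i :
  open U -> Ck k U f -> Ck k U (fun q => f q 0 i : R^o).
Proof.
move=> oU; pose c (x : 'rV[R]_n) : R^o := x 0 i.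
have lc : linear c by move=> a x y; rewrite /c !mxE.
pose L : {linear 'rV[R]_n -> R^o} :=
  HB.pack c (GRing.isLinear.Build _ _ _ _ _ lc).
apply: (@Ck_linear _ _ _ _ _ _ L) => //.
exact: matrix_normedtype.coord_continuous.
Qed.

Lemma Ck_sum (V W : normedModType R) (I : Type) (r : seq I) k (U : set V)
    (f : I -> V -> W) :
  open U -> (forall i, Ck k U (f i)) -> Ck k U (fun q => \sum_(i <- r) f i q).
Proof.
move=> oU fC; elim: r => [|i r IHr].
  rewrite [X in Ck _ _ X](_ : _ = cst 0); first exact: Ck_cst.
  by apply/funext => q; rewrite big_nil.
rewrite [X in Ck _ _ X](_ : _ = f i + (fun q => \sum_(j <- r) f j q)).
  exact: Ck_add.
by apply/funext => q; rewrite big_cons.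
Qed.

(* The derivative of [g \o f] in direction [v] is
   [\sum_i ('d f p v)_i *: 'd g (f p) e_i], whose factors are C^k. *)
Lemma Ck_comp (V W : normedModType R) n k (U : set V) (U' : set 'rV[R]_n)
    (f : V -> 'rV[R]_n) (g : 'rV[R]_n -> W) :
  open U -> f @` U `<=` U' -> Ck k U f -> Ck k U' g -> Ck k U (g \o f).
Proof.
move=> oU fU; have {}fU p : U p -> U' (f p) by move=> Up; apply: fU; exists p.
elim: k g => [|k IHk] g.
  move=> /= fC gC p Up; apply: continuous_comp; first exact: fC.
  exact/gC/fU.
move=> fC [dg Dg]; have fC' := CkS fC; case: fC => df Df.
split=> [p Up|v]; first exact: differentiable_comp (df p Up) (dg _ (fU p Up)).
pose h i p : W := ('d f p v 0 i : R^o) *: ('d g (f p) (delta_mx 0 i)).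
apply: (@Ck_ext _ _ _ _ _ (fun p => \sum_i h i p)) => //; last first.
  apply: Ck_sum => // i; apply: Ck_scale => //; first exact/Ck_coord/Df.
  exact: IHk fC' (Dg _).
move=> p /set_mem Up.
rewrite (diff_comp (df p Up) (dg _ (fU p Up))) /=.
rewrite [in LHS](row_sum_delta ('d f p v)) linear_sum /=.
by apply: eq_bigr => i _; rewrite linearZ.
Qed.

End calculus.

(** * Dimension counts for finite-dimensional spaces and complexes *)

Section linear_algebra.
Variable K : fieldType.

(* Choosing a basis of [S] gives an injection of [A] into K^(dim S). *)
Lemma separating_fullv (A : vectType K) (S : {vspace 'Hom(A, K^o)}) :
  (forall w, (forall f, f \in S -> f w = 0) -> w = 0) -> S = fullv.
Proof.
move=> sepS; apply/eqP; rewrite eqEdim subvf dimvf.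
have dA : dim 'Hom(A, K^o) = dim A by exact: muln1.
rewrite dA; pose ev (w : A) := \row_(i < \dim S) (vbasis S)`_i w.
have lev : linear ev.
  by move=> a u v; apply/rowP => i; rewrite !mxE linearP.
pose L : {linear A -> 'rV[K]_(\dim S)} :=
  HB.pack ev (GRing.isLinear.Build _ _ _ _ _ lev).
have injL : lker (linfun L) == 0%VS.
  rewrite -subv0; apply/subvP => w; rewrite memv_ker memv0 lfunE => /eqP Lw.
  apply/eqP/sepS => f /coord_vbasis ->; rewrite sum_lfunE big1 // => i _.
  have := congr1 (fun r : 'rV_ _ => r 0 i) Lw; rewrite !mxE => ev0.
  by rewrite scale_lfunE [X in _ *: X]ev0 scaler0.
have := limg_ker_dim (linfun L) fullv; rewrite (eqP injL) capv0 dimv0 add0n.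
rewrite dimvf => <-; apply: leq_trans (dimvS (subvf _)) _.
by rewrite dimvf dim_matrix mul1r.
Qed.

(* The Euler characteristic of the complex is zero. *)
Lemma exact_at_third (A B C D : vectType K) (f1 : 'Hom(A, B))
    (f2 : 'Hom(B, C)) (f3 : 'Hom(C, D)) :
  dim A = dim D -> dim B = dim C ->
  lker f1 = 0%VS -> lker f2 = limg f1 -> limg f3 = fullv ->
  (limg f2 <= lker f3)%VS -> lker f3 = limg f2.
Proof.
move=> AD BC k1 k2 i3 f32; apply/esym/eqP; rewrite eqEdim f32 /=.
have := limg_ker_dim f1 fullv; have := limg_ker_dim f2 fullv.
have := limg_ker_dim f3 fullv.
rewrite !capfv !dimvf i3 k2 k1 dimv0 dimvf -AD BC add0n => e3 e2 e1.
(* By rank-nullity, both sides become the common dimension of [B] and [C] once [dim A] is added. *)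
by rewrite -(leq_add2r (dim A)) e3 -e2 e1 addnC.
Qed.

End linear_algebra.

(** * Smooth maps, their tangent maps, and 2-forms *)

Section smooth_maps.
Variable R : realType.
Implicit Types M N P : manifold R.

Lemma near_coord M (x : M) (A : set M) :
  nbhs x A -> \forall p \near coord (chart_at x) x, A (param (chart_at x) p).
Proof.
move=> xA; have mx : dom (chart_at x) x := mem_chart_at x.
have : {for coord (chart_at x) x, continuous (param (chart_at x))}.
  by apply: param_continuous; exists x.
by apply; rewrite param_coord.
Qed.

(** Near the base point [f] stays in the domain of the chart at [f x], so that chart cancels and the
    local representatives compose. The neighbourhood [V] is shrunk until this holds and [Ck_comp]
    applies. *)
Lemma smooth_comp M N P (f : M -> N) (g : N -> P) :
  smooth f -> smooth g -> smooth (g \o f).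
Proof.
move=> [cf sf] [cg sg]; split.
  by move=> x; apply: continuous_comp; [exact: cf|exact: cg].
move=> x; have [U [oU Ux] fU] := sf x; have [U' [oU' Ux'] gU'] := sg (f x).
set p := coord (chart_at x) x in Ux *.
have fp : local_rep f x p = coord (chart_at (f x)) (f x).
  by rewrite /local_rep /= param_coord.
have fdom : \forall q \near p, dom (chart_at (f x)) (f (param (chart_at x) q)).
  apply: (@near_coord _ x (f @^-1` dom (chart_at (f x)))); apply: cf.
  by apply: open_nbhs_nbhs; split; [exact: dom_open|exact: mem_chart_at].
have fU' : \forall q \near p, U' (local_rep f x q).
  have : {for p, continuous (local_rep f x)} by exact: (fU 0%N).
  by apply; rewrite fp; exact: open_nbhs_nbhs.
have [V [[oV Vp] VE]] : exists V, open_nbhs p V /\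
    V `<=` [set q | [/\ U q, U' (local_rep f x q) &
      dom (chart_at (f x)) (f (param (chart_at x) q))]].
  have : nbhs p [set q | [/\ U q, U' (local_rep f x q) &
      dom (chart_at (f x)) (f (param (chart_at x) q))]].
    by apply: filterS3 fU' fdom (open_nbhs_nbhs (conj oU Ux)) => q ? ? ?; split.
  by rewrite nbhsE => -[V ? ?]; exists V.
exists V => // k.
apply: (@Ck_ext _ _ _ _ _ _ (local_rep g (f x) \o local_rep f x)) => //.
  by move=> q /set_mem /VE [_ _ /coordK fq]; rewrite /local_rep /= fq.
apply: (@Ck_comp _ _ _ _ _ _ U') => //.
  by move=> _ [q /VE [_ ? _] <-].
by apply: Ck_subset (fU k) => q /VE [].
Qed.

(** [param] is controlled only over the image of the chart domain, so the identity is represented by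
    the identity merely near the base point. *)
Lemma local_rep_id_near M (x : M) :
  exists2 U, open_nbhs (coord (chart_at x) x) U &
    {in U, local_rep (@id M) x =1 id}.
Proof.
exists (coord (chart_at x) @` dom (chart_at x)).
  by split; [exact: coord_open|exists x => //; exact: mem_chart_at].
by move=> _ /set_mem [y xy <-]; rewrite /local_rep /= coordK.
Qed.

Lemma smooth_id M : smooth (@id M).
Proof.
split=> [x|x]; first exact: cvg_id.
have [U xU idU] := local_rep_id_near x; exists U => // -[|k].
  by apply: Ck_ext (xU.1) idU _ => p _; exact: cvg_id.
apply: Ck_ext (xU.1) idU _; split=> [p _|v].
  by case: (is_diff_id p).
rewrite [X in Ck _ _ X](_ : _ = cst v); first exact: Ck_cst.
by apply/funext => p; case: (is_diff_id p) => _ ->.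
Qed.

Lemma tangent_map_id M (x : M) v : tangent_map (@id M) x v = v.
Proof.
have [U xU idU] := local_rep_id_near x; rewrite tangent_mapE.
have near_id : {near coord (chart_at x) x, local_rep (@id M) x =1 id}.
  by apply: filterS (open_nbhs_nbhs xU) => q Uq; exact/idU/mem_set.
have [did dE] := is_diff_id (coord (chart_at x) x).
by have [_ ->] := near_eq_is_diff near_id did; rewrite dE.
Qed.

(* Tangent spaces being spaces of coordinates, tangent vectors at provably
   equal points can be compared without transport. *)
Lemma tangent_map_eq M N (f g : M -> N) (x y : M) (v : 'rV[R]_(mdim M)) :
  f = g -> x = y ->
  tangent_map f x v = tangent_map g y v :> 'rV[R]_(mdim N).
Proof. by move=> -> ->. Qed.

(** The chain rule for a commuting triangle, with the middle point [y] given up to a proved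
    equality. This serves at units, where identities such as [tgt (idarr x) = x] do not hold by
    computation. *)
Lemma tangent_map_compE M N P (f : M -> N) (g : N -> P) (j : M -> P) x y
    (v : 'rV[R]_(mdim M)) :
  smooth f -> smooth g -> g \o f = j -> f x = y ->
  tangent_map g y (tangent_map f x v) = tangent_map j x v :> 'rV[R]_(mdim P).
Proof.
move=> sf sg gf <-; apply: etrans (tangent_map_eq v gf (erefl x)).
by rewrite (tangent_map_comp x sf sg) comp_lfunE.
Qed.

Lemma tangent_mapK M N (f : M -> N) (g : N -> M) x y (v : 'rV[R]_(mdim M)) :
  smooth f -> smooth g -> g \o f = id -> f x = y ->
  tangent_map g y (tangent_map f x v) = v :> 'rV[R]_(mdim M).
Proof.
move=> sf sg gf fx; apply: etrans (tangent_map_compE v sf sg gf fx) _.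
exact: (@tangent_map_id M x v).
Qed.

Lemma form2_eq M (w : diff_form M 2) (x y : M) (u v u' v' : 'rV[R]_(mdim M)) :
  x = y -> u = u' -> v = v' ->
  form2 w (x := x) u v = form2 w (x := y) u' v'.
Proof. by move=> -> -> ->. Qed.

Lemma pullback_form2 M N (f : M -> N) (w : diff_form N 2) x (u v : tangent x) :
  pullback f w (fun i => if i == ord0 then u else v) =
  form2 w (tangent_map f x u) (tangent_map f x v).
Proof.
rewrite /pullback /form2; congr (w (f x) _).
by apply/funext => i; case: ifP.
Qed.

End smooth_maps.

(** Polarization: expand the vanishing value of the form on [u + v] taken twice. *)
Lemma form2_antisym (R : realType) (M : manifold R) (w : diff_form M 2) (x : M)
    (u v : tangent x) : form2 w u v = - form2 w v u.
Proof.
have alt (t : tangent x) : form2 w t t = 0.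
  exact: (@form_alternating _ _ _ w x _ ord0 ord_max).
have addl (a b c : tangent x) :
    form2 w (a + b) c = form2 w a c + form2 w b c.
  by have := form2_linearl w c 1 a b; rewrite !scale1r.
have addr (a b c : tangent x) :
    form2 w a (b + c) = form2 w a b + form2 w a c.
  by have := form2_linearr w a 1 b c; rewrite !scale1r.
have := alt (u + v); rewrite addl !addr !alt add0r addr0 => /eqP.
by rewrite addr_eq0 => /eqP.
Qed.

Lemma form2_0r (R : realType) (M : manifold R) (w : diff_form M 2) (x : M)
    (u : tangent x) : form2 w u 0 = 0.
Proof. by rewrite -flatE linear0. Qed.

Lemma form2_0l (R : realType) (M : manifold R) (w : diff_form M 2) (x : M)
    (u : tangent x) : form2 w 0 u = 0.
Proof. by rewrite form2_antisym form2_0r oppr0. Qed.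

(** * Multiplicative 2-forms along the units *)

Section units.
Variables (R : realType) (G : lie_groupoid R).
Implicit Type x : base G.

Let smooth_src := (src_submersion G).1.
Let smooth_tgt := (tgt_submersion G).1.

Variable omega : diff_form (arrows G) 2.
Hypothesis mult_omega : forall p v,
  pullback (fun q : composable G => mult (pr1 q) (pr2 q)) omega (x := p) v =
  pullback pr1 omega v + pullback pr2 omega v.

Lemma form2_units x (u v : tangent (idarr x)) :
  form2 omega u v =
  form2 omega (x := idarr x)
    (tangent_map idarr x (tangent_map tgt (idarr x) u)) v +
  form2 omega u (tangent_map idarr x (tangent_map src (idarr x) v)).
Proof.
have [[sp1 sp2] _ pI pU] := composableP G.
pose m q := mult (@pr1 _ G q) (@pr2 _ G q); pose e := @idarr _ G.
have sm : smooth m := mult_smooth G.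
have se : smooth e := idarr_smooth G.
have id_smooth := @smooth_id _ (arrows G).
(* The universal property of composable pairs yields [h], sending g to (1_{t g}, g), and [k],
   sending g to (g, 1_{s g}), as smooth maps; both are sections of [m]. *)
have [h sh hE] := pU _ _ _ (smooth_comp smooth_tgt se) id_smooth
  (fun g => src_idarr (tgt g)).
have [k sk kE] := pU _ _ _ id_smooth (smooth_comp smooth_src se)
  (fun g => esym (tgt_idarr (src g))).
have h1 : pr1 \o h = e \o tgt by apply/funext => g; exact: (hE g).1.
have h2 : pr2 \o h = id by apply/funext => g; exact: (hE g).2.
have k1 : pr1 \o k = id by apply/funext => g; exact: (kE g).1.
have k2 : pr2 \o k = e \o src by apply/funext => g; exact: (kE g).2.
have mh : m \o h = id.
  apply/funext => g; rewrite /m /=.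
  by have [/= -> ->] := hE g; exact: mult_idl.
have mk : m \o k = id.
  apply/funext => g; rewrite /m /=.
  by have [/= -> ->] := kE g; exact: mult_idr.
(* Both are the pair (1_x, 1_x), so [U] and [V] below are tangent at the same point. *)
have kh : k (e x) = h (e x).
  have [h1x h2x] := hE (e x); have [k1x k2x] := kE (e x); apply: pI.
    by rewrite h1x k1x /= /e tgt_idarr.
  by rewrite h2x k2x /= /e src_idarr.
pose U : tangent (h (e x)) := tangent_map h (e x) u.
pose V : tangent (h (e x)) := tangent_map k (e x) v.
have := mult_omega (fun i : 'I_2 => if i == ord0 then U else V).
rewrite !pullback_form2.
have -> : form2 omega (tangent_map m _ U) (tangent_map m _ V) = form2 omega u v.
  apply: form2_eq; first exact: (congr1 (@^~ (e x)) mh).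
    exact: tangent_mapK.
  exact: tangent_mapK.
(* The first projections of [U] and [V] are T1 Tt u and v, the second ones u and T1 Ts v. *)
move=> ->; congr (_ + _); apply: form2_eq.
- by have [/= -> _] := hE (e x); rewrite /e tgt_idarr.
- apply: etrans (tangent_map_compE u sh sp1 h1 (erefl _)) _.
  apply/esym/tangent_map_compE => //; exact: tgt_idarr.
- exact: tangent_mapK.
- by have [/= _ ->] := hE (e x).
- exact: tangent_mapK.
- apply: etrans (tangent_map_compE v sk sp2 k2 kh) _.
  apply/esym/tangent_map_compE => //; exact: src_idarr.
Qed.

Lemma form2_ker_tgt x (u v : tangent (idarr x)) :
  tangent_map tgt (idarr x) u = 0 ->
  form2 omega u v =
  form2 omega u (tangent_map idarr x (tangent_map src (idarr x) v)).
Proof.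
move=> tu; have e : tangent_map idarr x (tangent_map tgt (idarr x) u) = 0.
  exact: etrans (congr1 (tangent_map idarr x) tu) (linear0 _).
apply: etrans (form2_units u v) _.
apply: etrans (congr1 (+%R^~ _) (form2_eq omega (erefl _) e (erefl v))) _.
by rewrite form2_0l add0r.
Qed.

Lemma form2_ker_src x (u v : tangent (idarr x)) :
  tangent_map src (idarr x) v = 0 ->
  form2 omega u v =
  form2 omega (x := idarr x)
    (tangent_map idarr x (tangent_map tgt (idarr x) u)) v.
Proof.
move=> sv; have e : tangent_map idarr x (tangent_map src (idarr x) v) = 0.
  exact: etrans (congr1 (tangent_map idarr x) sv) (linear0 _).
apply: etrans (form2_units u v) _.
apply: etrans (congr1 (+%R _) (form2_eq omega (erefl _) (erefl u) e)) _.
by rewrite form2_0r addr0.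
Qed.

End units.

(** * The algebroid of a quasi-symplectic groupoid as a Dirac structure *)

Section algebroid.
Variables (R : realType) (G : lie_groupoid R).
Variables (omega : diff_form (arrows G) 2) (eta : diff_form (base G) 3).
Implicit Type x : base G.

Lemma anchorE x (u : algebroid x) :
  anchor x u = tangent_map tgt (idarr x) (vsval u).
Proof.
have uE : linfun (@vsval _ _ (ker_src x)) u = vsval u by exact: lfunE.
by rewrite comp_lfunE uE.
Qed.

Lemma src_vsval x (u : algebroid x) : tangent_map src (idarr x) (vsval u) = 0.
Proof. by apply/eqP; rewrite -memv_ker; exact: subvsP. Qed.

Hypothesis hG : shifted_symplectic omega eta.

(** Rank-nullity for the surjective T s, whose source has twice the dimension of its target. *)
Lemma dim_algebroid x : dim (algebroid x) = mdim (base G).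
Proof.
have [_ _ _ dimG _] := hG.
have := limg_ker_dim (tangent_map src (idarr x)) fullv.
rewrite capfv (src_submersion G).2 !dimvf.
have -> : dim (tangent (idarr x)) = (2 * mdim (base G))%N.
  by rewrite dim_matrix mul1r.
have -> : dim (tangent (src (idarr x))) = mdim (base G).
  by rewrite dim_matrix mul1r.
by rewrite mul2n -addnn => /addIn.
Qed.

(** When Tt u = 0, [form2_ker_tgt] gives omega(u, v) = lambda(u)(Ts v). So lambda(u) = 0 puts u in
    the kernel of omega as well, and nondegeneracy at the unit applies. *)
Lemma anchor_lambda_inj x (u : algebroid x) :
  anchor x u = 0 -> lambda omega u = 0 -> u = 0.
Proof.
have [mult_omega _ _ _ ndeg] := hG => au lu; apply: subvs_inj.
have tu : tangent_map tgt (idarr x) (vsval u) = 0 by rewrite -anchorE.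
have v0 : vsval (0 : algebroid x) = 0 by exact: linear0.
rewrite v0; apply: (ndeg x (vsval u) (src_vsval u)) => // v.
apply: etrans (form2_ker_tgt mult_omega v tu) _.
have := congr1 (fun f : cotangent x => f (tangent_map src (idarr x) v)) lu.
by rewrite lambdaE zero_lfunE.
Qed.

(* [L] is isotropic for the canonical pairing. *)
Lemma lambda_anchor x (u v : algebroid x) :
  lambda omega v (anchor x u) = - lambda omega u (anchor x v).
Proof.
have [mult_omega _ _ _ _] := hG.
have lE (a b : algebroid x) :
    lambda omega a (anchor x b) = - form2 omega (vsval b) (vsval a).
  rewrite lambdaE (form2_antisym omega) anchorE; congr (- _); apply/esym.
  exact (form2_ker_src mult_omega (vsval b) (src_vsval a)).
by rewrite !lE (form2_antisym omega (vsval v)) opprK.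
Qed.

End algebroid.

(** * The complex of an isotropic morphism, fibre by fibre *)

Section morphism.
Variables (R : realType) (G H : lie_groupoid R).
Variables (omega : diff_form (arrows G) 2) (eta : diff_form (base G) 3).
Variables (Phi : lie_groupoid_morphism H G) (sigma : diff_form (base H) 2).
Hypothesis (hG : shifted_symplectic omega eta).
Hypothesis (hPhi : isotropic omega eta Phi sigma).
Local Notation phi := (on_base Phi).
Implicit Type x : base H.

Lemma anchor_lie x (w : algebroid x) :
  tangent_map phi x (anchor x w) = anchor (phi x) (lie Phi x w).
Proof.
rewrite !anchorE vsval_lie.
have e : phi \o tgt = tgt \o Phi by apply/funext => h /=; rewrite tgt_on_arrows.
apply: etrans (tangent_map_compE _ (tgt_submersion H).1 (on_base_smooth Phi) e
  (tgt_idarr x)) _.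
apply/esym/(tangent_map_compE _ (on_arrows_smooth Phi)) => //.
  exact: (tgt_submersion G).1.
exact: on_arrows_idarr.
Qed.

(** The isotropic condition at the unit, evaluated on T1 Y and w: the source term dies since w lies
    in ker Ts, and the target term is sigma(Y, a w). The sign it carries matches the one from
    swapping the arguments of omega. *)
Lemma lambda_lie x (w : algebroid x) (Y : tangent x) :
  lambda omega (lie Phi x w) (tangent_map phi x Y) = form2 sigma Y (anchor x w).
Proof.
pose V i := if i == ord0 :> 'I_2 then tangent_map idarr x Y else vsval w.
have := hPhi.1 (idarr x) V; rewrite !pullback_form2 => sigma_omega.
have s0 : form2 sigma (tangent_map src (idarr x) (tangent_map idarr x Y))
    (tangent_map src (idarr x) (vsval w)) = 0.
  by apply: etrans (form2_0r _ _); apply: form2_eq (src_vsval w).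
have t0 : form2 sigma (tangent_map tgt (idarr x) (tangent_map idarr x Y))
    (tangent_map tgt (idarr x) (vsval w)) = form2 sigma Y (anchor x w).
  apply: form2_eq (tgt_idarr x) _ (esym (anchorE w)).
  apply: tangent_mapK (idarr_smooth H) (tgt_submersion H).1 _ (erefl _).
  by apply/funext => y; exact: tgt_idarr.
have p0 : form2 omega (tangent_map Phi (idarr x) (tangent_map idarr x Y))
    (tangent_map Phi (idarr x) (vsval w)) =
  - lambda omega (lie Phi x w) (tangent_map phi x Y).
  rewrite lambdaE -form2_antisym.
  apply: form2_eq (on_arrows_idarr Phi x) _ (esym (vsval_lie Phi w)).
  have c : Phi \o idarr = idarr \o phi.
    by apply/funext => y; exact: on_arrows_idarr.
  apply: etrans (tangent_map_compE Y (idarr_smooth H) (on_arrows_smooth Phi) c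
    (erefl _)) _.
  by apply/esym/(tangent_map_compE _ (on_base_smooth Phi) (idarr_smooth G)).
have := etrans (esym (congr2 (fun a b => a - b) s0 t0)) (etrans sigma_omega p0).
by rewrite sub0r => /oppr_inj.
Qed.

Lemma lagr3E x z (w : algebroid x) :
  lagr3 omega Phi x z w =
  - lambda omega (lie Phi x w) z.1 + z.2 (anchor x w).
Proof.
rewrite add_lfunE opp_lfunE; congr (- _ + _); last exact: comp_lfunE.
by rewrite comp_lfunE lambda_dualE.
Qed.

Lemma lagr1_linear x : linear (lagr1 Phi x).
Proof. by move=> a u v; rewrite /lagr1 !linearP. Qed.

Lemma lagr2_linear x : linear (lagr2 omega Phi sigma x).
Proof.
move=> a [Y u] [Y' u']; congr pair => /=.
  rewrite -[RHS]/(a *: (_ - _) + (_ - _)).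
  rewrite (linearP (tangent_map phi x)) (linearP (anchor (phi x))) /=.
  by rewrite scalerBr opprD addrACA.
rewrite -[RHS]/(a *: (_ + _) + (_ + _)) flat_linear lambda_linear.
apply/lfunP => X; rewrite !(add_lfunE, scale_lfunE).
rewrite !(comp_lfunE _ (tangent_map phi x)).
by rewrite !(add_lfunE, scale_lfunE) scalerDr addrACA.
Qed.

Lemma lagr3_linear x : linear (lagr3 omega Phi x).
Proof.
move=> a [X f] [X' f']; apply/lfunP => w.
rewrite [RHS]add_lfunE scale_lfunE !(lagr3E (_, _)).
rewrite (linearP (lambda omega (lie Phi x w))) add_lfunE scale_lfunE /=.
by rewrite scalerDr opprD scalerN addrACA.
Qed.

(** The two sigma terms cancel by [lambda_lie]; the two terms in [u] cancel by [anchor_lie] and the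
    isotropy of L. *)
Lemma lagr3_lagr2 x z : lagr3 omega Phi x (lagr2 omega Phi sigma x z) = 0.
Proof.
case: z => Y u; apply/lfunP => w; rewrite zero_lfunE lagr3E.
have -> : lambda omega (lie Phi x w) (lagr2 omega Phi sigma x (Y, u)).1 =
    form2 sigma Y (anchor x w) - lambda omega (lie Phi x w) (anchor (phi x) u).
  by rewrite -lambda_lie -linearB.
have -> : (lagr2 omega Phi sigma x (Y, u)).2 (anchor x w) =
    form2 sigma Y (anchor x w) + lambda omega u (anchor (phi x) (lie Phi x w)).
  by rewrite -anchor_lie -flatE -(comp_lfunE (lambda omega u)) -add_lfunE.
by rewrite (lambda_anchor hG u) opprK addNr.
Qed.

Lemma lagr3_separating x :
  injective (lagr1 Phi x) ->
  forall w : algebroid x, (forall z, lagr3 omega Phi x z w = 0) -> w = 0.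
Proof.
move=> inj1 w lw.
have aw : anchor x w = 0.
  apply/rowP => i; rewrite mxE.
  (* Testing on (0, alpha) with alpha a coordinate functional reads off the entries of the anchor of
     [w]. *)
  pose c (v : tangent x) : R^o := (v : 'rV[R]_(mdim (base H))) 0 i.
  have lc : linear c by move=> a u v; rewrite /c !mxE.
  pose C : {linear tangent x -> R^o} :=
    HB.pack c (GRing.isLinear.Build _ _ _ _ _ lc).
  have := lw (0, linfun C); rewrite lagr3E /= linear0 oppr0 add0r.
  by rewrite (lfunE C).
have lieaw : anchor (phi x) (lie Phi x w) = 0 by rewrite -anchor_lie aw linear0.
have lielw : lambda omega (lie Phi x w) = 0.
  apply/lfunP => X; have := lw (X, 0); rewrite lagr3E /= !zero_lfunE addr0.
  by move/eqP; rewrite oppr_eq0 => /eqP.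
have lw0 : lie Phi x w = 0 by exact: (anchor_lambda_inj hG).
by apply: inj1; rewrite /lagr1 aw lw0 !linear0.
Qed.

Lemma lagrangian_at x :
  injective (lagr1 Phi x) ->
  [set z | lagr2 omega Phi sigma x z = 0] = range (lagr1 Phi x) ->
  [set z | lagr3 omega Phi x z = 0] = range (lagr2 omega Phi sigma x) /\
  range (lagr3 omega Phi x) = setT.
Proof.
move=> inj1 ker2.
pose L1 : {linear _ -> _} := HB.pack (lagr1 Phi x)
  (GRing.isLinear.Build _ _ _ _ _ (@lagr1_linear x)).
pose L2 : {linear _ -> _} := HB.pack (lagr2 omega Phi sigma x)
  (GRing.isLinear.Build _ _ _ _ _ (@lagr2_linear x)).
pose L3 : {linear _ -> _} := HB.pack (lagr3 omega Phi x)
  (GRing.isLinear.Build _ _ _ _ _ (@lagr3_linear x)).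
have E1 w : linfun L1 w = lagr1 Phi x w := lfunE L1 w.
have E2 z : linfun L2 z = lagr2 omega Phi sigma x z := lfunE L2 z.
have E3 z : linfun L3 z = lagr3 omega Phi x z := lfunE L3 z.
have img3 : limg (linfun L3) = fullv.
  apply: separating_fullv => w sep; apply: (lagr3_separating inj1) => z.
  by rewrite -E3; apply: sep; rewrite memv_img ?memvf.
have k3 : lker (linfun L3) = limg (linfun L2).
  apply: (exact_at_third (f1 := linfun L1)) img3 _.
  - by rewrite -[RHS]/(dim (algebroid x) * 1)%N muln1.
  (* The middle terms have dimensions dim N + rank A_G and dim M + dim N; [dim_algebroid] makes them
     equal. *)
  - rewrite -[LHS]/(dim (tangent x) + dim (algebroid (phi x)))%N.
    rewrite -[RHS]/(dim (tangent (phi x)) + dim (tangent x) * 1)%N.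
    by rewrite muln1 addnC (dim_algebroid hG) [in RHS]dim_matrix mul1r.
  - by apply/eqP/lker0P => u v; rewrite !E1; exact: inj1.
  - apply/vspaceP => z; rewrite memv_ker E2.
    apply/eqP/memv_imgP => [z0|[w _ ->]].
      have [w _ <-] : range (lagr1 Phi x) z by rewrite -ker2.
      by exists w; rewrite ?memvf ?E1.
    rewrite E1; suff : [set z | lagr2 omega Phi sigma x z = 0] (lagr1 Phi x w).
      by [].
    by rewrite ker2; exists w.
  - apply/subvP => _ /memv_imgP [z _ ->].
    by rewrite memv_ker E2 E3 lagr3_lagr2.
split; apply/seteqP; split=> //.
- move=> z /= z0; have : z \in lker (linfun L3) by rewrite memv_ker E3 z0.
  by rewrite k3 => /memv_imgP [y _ ->]; exists y; rewrite ?E2.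
- by move=> _ [y _ <-] /=; exact: lagr3_lagr2.
- move=> f _; have : f \in limg (linfun L3) by rewrite img3 memvf.
  by move=> /memv_imgP [z _ ->]; exists z; rewrite ?E3.
Qed.

Lemma to_tangent_times_dirac_inj x :
  injective (to_tangent_times_dirac omega Phi x).
Proof.
move=> [Y u] [Y' u'] [-> au lu]; congr pair.
apply/eqP; rewrite -subr_eq0; apply/eqP/(anchor_lambda_inj hG).
  by rewrite linearB /= au subrr.
have := lambda_linear omega (-1) u' u; rewrite !scaleN1r => e.
by rewrite addrC e lu addNr.
Qed.

(** With (X, alpha) = (a u, lambda u) and beta = 0, the two equations defining [graph_dirac] are the
    two components of [lagr2] vanishing at (Y, u). *)
Lemma graph_tangent_times_dirac x (z : ambient Phi x) :
  (graph_dirac Phi sigma x `&` tangent_times_dirac omega Phi x) z <->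
  exists2 y, lagr2 omega Phi sigma x y = 0 &
    to_tangent_times_dirac omega Phi x y = z.
Proof.
split.
  case: z => -[Y b] [X a] [[/= -> ->] [/= b0 [u _ [ua ul]]]].
  exists (Y, u); last by rewrite /to_tangent_times_dirac /= ua ul b0.
  by rewrite /lagr2 /= ua subrr addrC ul b0.
case=> -[Y u] [/= /eqP Xe be] <-; rewrite subr_eq0 in Xe.
split; split => //=; first by rewrite (eqP Xe).
- by rewrite addrC be.
- by exists u.
Qed.

End morphism.

Theorem proposition2p24 (R : realType) (G : lie_groupoid R)
    (omega : diff_form (arrows G) 2) (eta : diff_form (base G) 3)
    (hG : shifted_symplectic omega eta)
    (H : lie_groupoid R) (Phi : lie_groupoid_morphism H G)
    (sigma : diff_form (base H) 2) (hPhi : isotropic omega eta Phi sigma) :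
  lagrangian omega Phi sigma <->
  isomorphism_onto
    (fun x (w : algebroid x) =>
       to_tangent_times_dirac omega Phi x (lagr1 Phi x w))
    (fun x => graph_dirac Phi sigma x `&` tangent_times_dirac omega Phi x).
Proof.
split=> [L x|I x].
  have [inj1 ker2 _ _] := L x; split.
    move=> a u v; rewrite lagr1_linear /to_tangent_times_dirac /=.
    rewrite linearP lambda_linear; congr (_, _, _).
    by rewrite -[RHS]/(a *: 0 + 0) scaler0 addr0.
  split.
  - move=> w _; apply/graph_tangent_times_dirac; exists (lagr1 Phi x w) => //.
    suff : [set z | lagr2 omega Phi sigma x z = 0] (lagr1 Phi x w) by [].
    by rewrite ker2; exists w.
  - by move=> u v _ _ /(to_tangent_times_dirac_inj hG) /inj1.
  - move=> z /graph_tangent_times_dirac [y y0 <-].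
    have [w _ <-] : range (lagr1 Phi x) y by rewrite -ker2.
    by exists w.
have [_ [img inj surj]] := I x.
have inj1 : injective (lagr1 Phi x).
  by move=> u v uv; apply: inj; rewrite ?inE // uv.
have ker2 : [set z | lagr2 omega Phi sigma x z = 0] = range (lagr1 Phi x).
  apply/seteqP; split=> [y y0|_ [w _ <-]].
    (* A kernel element gives a point of the intersection, hence a preimage [w]; injectivity of the
       embedding then identifies [lagr1 Phi x w] with [y]. The converse inclusion below uses the
       same injectivity. *)
    have [|w _ /(to_tangent_times_dirac_inj hG) wy] :=
      surj (to_tangent_times_dirac omega Phi x y).
      by apply/graph_tangent_times_dirac; exists y.
    by exists w.
  have /graph_tangent_times_dirac [y y0] := img w Logic.I.
  by move/(to_tangent_times_dirac_inj hG) => <-.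
by have [] := lagrangian_at hG hPhi inj1 ker2; split.
Qed.
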